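(* For every prime $p\ge 3$, we have $$r_p(\mathbb{F}_p^3)\ge p^3-3p^2+\frac18p^{3/2}-\frac{7}{16}p.$$ As a consequence, $r_p(\mathbb{F}_p^3)\ge (p-1)^3+\frac18p^{3/2}-O(p)$ as the prime $p$ tends to infinity.
   Context: For a prime $p$, $r_p(\mathbb{F}_p^3)$ denotes the largest size of a subset $S\subseteq\mathbb{F}_p^3$ containing no nontrivial $p$-term arithmetic progression, i.e., no full affine line $\{\mathbf{a}+\lambda\mathbf{v}:\lambda\in\mathbb{F}_p\}$ with $\mathbf{a},\mathbf{v}\in\mathbb{F}_p^3$, $\mathbf{v}\neq\mathbf{0}$. *)

(* Defs.v *)
From HB Require Import structures.
From mathcomp Require Import all_boot all_order all_algebra.
Set Implicit Arguments. Unset Strict Implicit. Unset Printing Implicit Defensive.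
Import Order.TTheory GRing.Theory Num.Theory.
Local Open Scope ring_scope.

Definition line_free (p : nat) (S : {set 'rV['F_p]_3}) : bool :=
  [forall a : 'rV['F_p]_3, forall v : 'rV['F_p]_3,
     (v != 0) ==> ~~ [forall l : 'F_p, a + l *: v \in S]].

Definition r_p3 (p : nat) : nat :=
  \max_(S : {set 'rV['F_p]_3} | line_free S) #|S|.

(* Main.v *)
Require Import Defs.
From HB Require Import structures.
From mathcomp Require Import all_boot all_order all_algebra.
From mathcomp Require Import ring lra zify.
Set Implicit Arguments. Unset Strict Implicit. Unset Printing Implicit Defensive.
Import Order.TTheory GRing.Theory Num.Theory.
Local Open Scope ring_scope.

(** Write p = 2n+1. Start from the points off the planes x = 0, y = 0, z = 0 and
    x = y + z, and add points of the three coordinate planes selected by quadratic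
    residuosity: (0,y,z) with -yz a nonsquare, (x,0,z) with x, z distinct nonzero squares,
    and (x,y,0) with x, y distinct nonsquares. By Menelaus' theorem a line crossing
    the three coordinate planes at distinct points meets them at (0,y0,z0), (x1,0,z1),
    (x2,y2,0) with x1 z1 x2 y2 equal to -y0 z0 times a square, so it leaves the set.
    The set obtained in this way has (p-1)^3 points.

    The gain comes from swaps: for a set K of about sqrt p nonsquares, k in K, and a
    nonsquare with 1 - a a nonzero square, the two points (a,0,k) and (k,ka,k(1-a)) are
    added and the single point (a,ka,k(1-a)) is removed, which destroys the full line
    {(t,ka,k(1-a))} that would appear. Excluding the pairs with a in K or k(1-a) in K
    keeps the swaps from interfering. There are about p/4 values of a, hence about
    p^{3/2}/4 swaps, of which the exclusions cost at most 2|K|^2 <= 2p. *)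

Section LineFreeSet.
Variables (F : finFieldType) (n : nat).
Hypothesis char_neq2 : (2 : F) != 0.
Hypothesis cardF : #|F| = n.*2.+1.

(** * Squares and nonsquares in a finite field of odd order *)

Definition is_sq (x : F) : bool := [exists y, x == y ^+ 2].

Lemma is_sqX2 y : is_sq (y ^+ 2).
Proof. by apply/existsP; exists y. Qed.

Lemma is_sq0 : is_sq 0.
Proof. by have := is_sqX2 0; rewrite expr0n. Qed.

Lemma is_sq1 : is_sq 1.
Proof. by have := is_sqX2 1; rewrite expr1n. Qed.

Lemma nsq_neq0 x : ~~ is_sq x -> x != 0.
Proof. by apply: contraNneq => ->; apply: is_sq0. Qed.

Lemma is_sqM x y : is_sq x -> is_sq y -> is_sq (x * y).
Proof. by move=> /existsP[a /eqP->] /existsP[b /eqP->]; rewrite -exprMn is_sqX2. Qed.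

Lemma is_sqV x : is_sq x^-1 = is_sq x.
Proof.
suff H z : is_sq z -> is_sq z^-1 by apply/idP/idP => /H; rewrite ?invrK.
by move=> /existsP[a /eqP->]; rewrite -exprVn is_sqX2.
Qed.

Definition sqs := [set x : F | (x != 0) && is_sq x].
Definition nsqs := [set x : F | ~~ is_sq x].
Definition units := [set x : F | x != 0].

Lemma card_units : #|units| = n.*2.
Proof.
have := cardsC1 (0 : F); rewrite cardF /= => <-.
by apply: eq_card => x; rewrite !inE.
Qed.

(** Squaring is two-to-one on [units], since [y] and [- y] differ when 2 is invertible. *)
Lemma card_sqs : #|sqs| = n.
Proof.
apply: double_inj; rewrite -card_units; apply/esym; rewrite -sum1_card.
rewrite (partition_big_imset (fun y : F => y ^+ 2)) /=.
have -> : [set y ^+ 2 | y in units] = sqs.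
  apply/setP => x; rewrite inE; apply/imsetP/andP => [[y]|[x0 /existsP[y /eqP xy]]].
    by rewrite inE => y0 ->; rewrite expf_neq0 ?is_sqX2.
  by exists y => //; rewrite inE; apply: contraNneq x0 => y0; rewrite xy y0 expr0n.
transitivity (\sum_(x in sqs) 2)%N.
  apply: eq_bigr => x; rewrite inE => /andP[x0 /existsP[y /eqP xy]].
  have y0 : y != 0 by apply: contraNneq x0 => y0; rewrite xy y0 expr0n.
  have yNy : y != - y.
    by rewrite -addr_eq0 -mulr2n -mulr_natl mulf_neq0.
  transitivity #|[set y; - y]|; last by rewrite cards2 yNy.
  rewrite -sum1_card; apply: eq_bigl => z; rewrite !inE xy eqf_sqr.
  apply/andP/idP => [[] //|/orP[]/eqP->]; by rewrite ?oppr_eq0 eqxx ?orbT.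
by rewrite sum_nat_const muln2.
Qed.

Lemma card_nsqs : #|nsqs| = n.
Proof.
have := cardsID sqs units; rewrite card_units.
have -> : units :&: sqs = sqs.
  by apply/setP => x; rewrite !inE andbA andbb.
have -> : units :\: sqs = nsqs.
  apply/setP => x; rewrite !inE negb_and negbK.
  by have [->|_] := eqVneq x 0; rewrite ?is_sq0 ?andbT.
rewrite card_sqs; lia.
Qed.

Lemma nsqMsq x y : ~~ is_sq x -> y != 0 -> is_sq y -> ~~ is_sq (x * y).
Proof.
move=> Nx y0 Sy; apply: contra Nx => Sxy.
by rewrite -(mulfK y0 x) is_sqM ?is_sqV.
Qed.

(* Multiplication by a nonsquare maps the squares injectively, hence onto, the nonsquares. *)
Lemma nsqM x y : ~~ is_sq x -> ~~ is_sq y -> is_sq (x * y).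
Proof.
move=> Nx Ny; have x0 := nsq_neq0 Nx.
have E : [set x * s | s in sqs] = nsqs.
  apply/eqP; rewrite eqEcard card_imset ?card_sqs ?card_nsqs ?leqnn ?andbT; last exact: mulfI.
  by apply/subsetP => _ /imsetP[s + ->]; rewrite !inE => /andP[s0 Ss]; rewrite nsqMsq.
have : y \in nsqs by rewrite inE.
rewrite -E => /imsetP[s]; rewrite inE => /andP[_ Ss] ->.
by rewrite mulrA -expr2 is_sqM ?is_sqX2.
Qed.

Lemma is_sqMb x y : x != 0 -> y != 0 -> is_sq (x * y) = (is_sq x == is_sq y).
Proof.
move=> x0 y0; case Sx: (is_sq x); case Sy: (is_sq y) => /=.
- by rewrite is_sqM.
- by apply/negbTE; rewrite mulrC nsqMsq ?Sy.
- by apply/negbTE; rewrite nsqMsq ?Sx.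
- by rewrite nsqM ?Sx ?Sy.
Qed.

Definition nsq_1Bsq := [set a : F | [&& ~~ is_sq a, 1 - a != 0 & is_sq (1 - a)]].

Lemma is_sq_1BV a : a != 0 -> 1 - a != 0 ->
  is_sq (1 - a^-1) = ((is_sq (-1) == is_sq (1 - a)) == is_sq a).
Proof.
move=> a0 a1; have -> : 1 - a^-1 = (-1) * (1 - a) * a^-1 by field.
by rewrite !is_sqMb ?mulf_neq0 ?invr_eq0 ?oppr_eq0 ?oner_eq0 ?is_sqV.
Qed.

(* The involutions a |-> 1 - a and a |-> 1/a identify the classes of the pair of
   quadratic characters of a and 1 - a. *)
Lemma card_nsq_1Bsq : (n <= (#|nsq_1Bsq|).*2.+1)%N.
Proof.
have subN1 (a : F) : ~~ is_sq a -> 1 - a != 0.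
  by apply: contraNneq => /eqP; rewrite subr_eq0 => /eqP <-; apply: is_sq1.
have [S1|N1] := boolP (is_sq (-1)).
  have := cardsID nsq_1Bsq nsqs; rewrite card_nsqs => <-.
  have -> : nsqs :&: nsq_1Bsq = nsq_1Bsq.
    by apply/setP => a; rewrite !inE andbA andbb.
  (* When -1 is a square, inversion turns a nonsquare [a] with [1 - a] nonsquare into one with
     [1 - a^-1] square. *)
  suff : (#|nsqs :\: nsq_1Bsq| <= #|nsq_1Bsq|)%N by lia.
  rewrite -(card_imset _ invr_inj); apply: subset_leq_card.
  apply/subsetP => _ /imsetP[a + ->]; rewrite !inE => /andP[+ Na].
  rewrite Na /= (subN1 _ Na) /= => N1a.
  by rewrite is_sqV Na subN1 ?is_sqV // is_sq_1BV ?subN1 ?nsq_neq0 // S1 (negbTE N1a) (negbTE Na).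
(* When -1 is a nonsquare, inversion embeds [C] in [D], the map [1 - a] embeds [D] in [nsq_1Bsq],
   and 1, [C], [D] cover the nonzero squares. *)
pose D := [set a : F | is_sq a && ~~ is_sq (1 - a)].
pose C := [set a : F | [&& a != 0, 1 - a != 0, is_sq a & is_sq (1 - a)]].
have cD : (#|D| <= #|nsq_1Bsq|)%N.
  rewrite -(card_imset D (f := fun a => 1 - a)); last by move=> a b /addrI/oppr_inj.
  apply: subset_leq_card; apply/subsetP => _ /imsetP[a + ->]; rewrite !inE => /andP[Sa Na].
  by rewrite Na opprB addrC subrK Sa andbT; apply: contraNneq Na => ->; rewrite subr0 is_sq1.
have cC : (#|C| <= #|D|)%N.
  rewrite -(card_imset _ invr_inj); apply: subset_leq_card.
  apply/subsetP => _ /imsetP[a + ->]; rewrite !inE => /and4P[a0 a1 Sa Sa1].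
  by rewrite is_sqV Sa /= is_sq_1BV // (negbTE N1) Sa1 Sa.
have : (#|sqs| <= #|(1%R : F) |: (C :|: D)|)%N.
  apply: subset_leq_card; apply/subsetP => a; rewrite !inE => /andP[a0 Sa].
  rewrite a0 Sa /=; have [//|a1] := eqVneq a 1.
  by rewrite subr_eq0 eq_sym a1 orbN.
rewrite card_sqs cardsU1 cardsU; lia.
Qed.

(** * The point set and the absence of full lines in it *)

Variable K : {set F}.
Hypothesis subK : K \subset nsqs.

Lemma nsqK k : k \in K -> ~~ is_sq k.
Proof. by move/(subsetP subK); rewrite inE. Qed.

(* The pairs (a, k) for which (a,0,k) and (k,ka,k(1-a)) are traded for (a,ka,k(1-a)). *)
Definition swap_pair (a k : F) : bool :=
  [&& k \in K, a \in nsq_1Bsq, a \notin K & k * (1 - a) \notin K].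

(** The first special plane through a point decides. An added point on x = y + z has k = x and a =
    y/x; a removed point has a = x and k = y + z. *)
Definition in_S (x y z : F) : bool :=
  if x == 0 then [&& y != 0, z != 0 & ~~ is_sq (- (y * z))]
  else if y == 0 then
    (z != 0) && ([&& is_sq x, is_sq z & x != z] || swap_pair x z)
  else if z == 0 then [&& ~~ is_sq x, ~~ is_sq y & x != y]
  else if x == y + z then swap_pair (y / x) x
  else ~~ (swap_pair x (y + z) && (y == (y + z) * x)).

Lemma swap_pairP a k : swap_pair a k ->
  [/\ k \in K, ~~ is_sq a, 1 - a != 0, is_sq (1 - a) &
      a \notin K /\ k * (1 - a) \notin K].
Proof. by rewrite /swap_pair inE => /and4P[? /and3P[? ? ?] ? ?]; split. Qed.

Lemma in_S_x0 y z : in_S 0 y z -> [/\ y != 0, z != 0 & ~~ is_sq (- (y * z))].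
Proof. by rewrite /in_S eqxx => /and3P. Qed.

Lemma in_S_y0 x z : in_S x 0 z ->
  [/\ x != 0, z != 0, x != z, is_sq x = is_sq z & ~~ is_sq x -> swap_pair x z].
Proof.
rewrite /in_S eqxx; have [//|x0 /andP[z0]] := eqVneq x 0.
case/orP => [/and3P[Sx Sz xz]|sw]; first by split; rewrite ?Sx ?Sz.
have [Kz Nx _ _ [xK _]] := swap_pairP sw; have Nz := nsqK Kz.
by split; rewrite ?(negbTE Nx) ?(negbTE Nz) //; apply: contraNneq xK => ->.
Qed.

Lemma in_S_z0 x y : in_S x y 0 ->
  [/\ x != 0, y != 0, ~~ is_sq x, ~~ is_sq y & x != y].
Proof.
rewrite /in_S eqxx; have [_|x0] := eqVneq x 0; first by rewrite andbF.
by have [//|y0 /and3P[]] := eqVneq y 0.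
Qed.

(** If y + z = 0 the point also lies on x = 0, where - yz = z^2 being a square excludes it. *)
Lemma in_S_plane y z : y != 0 -> z != 0 -> in_S (y + z) y z ->
  swap_pair (y / (y + z)) (y + z).
Proof.
move=> y0 z0; rewrite /in_S (negbTE y0) (negbTE z0) eqxx.
have [yz|//] := eqVneq (y + z) 0.
by rewrite (_ : y = - z) ?mulNr ?opprK -?expr2 ?is_sqX2 ?andbF //; apply/eqP; rewrite -addr_eq0 yz.
Qed.

(** The coordinates y and z sum to k, so the last clause removes the point unless a = k; that case
    is ruled out by [a \notin K]. *)
Lemma notin_S_swap a k : swap_pair a k -> ~~ in_S a (k * a) (k * (1 - a)).
Proof.
move=> sw; have [Kk Na a1 _ [aK _]] := swap_pairP sw.
have a0 := nsq_neq0 Na; have k0 := nsq_neq0 (nsqK Kk).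
have -> : in_S a (k * a) (k * (1 - a)) =
  if a == k * a + k * (1 - a) then swap_pair (k * a / a) a
  else ~~ (swap_pair a (k * a + k * (1 - a)) && (k * a == (k * a + k * (1 - a)) * a)).
  by rewrite /in_S !mulf_eq0 (negbTE a0) (negbTE k0) (negbTE a1).
rewrite -mulrDr subrKC mulr1 eqxx sw /=.
by case: eqP => // ak; rewrite ak Kk in aK.
Qed.

(* Menelaus: the line meets the coordinate planes at (0,y0,z0), (x1,0,z1), (x2,y2,0), and
   x1 z1 x2 y2 is a square multiple of - y0 z0. *)
Lemma in_S_line_free_transversal x y z a b e : a != 0 -> b != 0 -> e != 0 ->
  exists l : F, ~~ in_S (x + l * a) (y + l * b) (z + l * e).
Proof.
move=> a0 b0 e0; apply/existsP; rewrite -negb_forall; apply/negP => /forallP H.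
have := H (- x / a); have := H (- y / b); have := H (- z / e).
rewrite !mulfVK // !subrr.
move=> /in_S_z0[x2 y2 Nx2 Ny2 _] /in_S_y0[x1 z1 _ E1 _] /in_S_x0[y0 z0].
have S1 : is_sq ((x + - y / b * a) * (z + - y / b * e)) by rewrite is_sqMb // E1.
have S2 := nsqM Nx2 Ny2.
have nz : a * (y / b - z / e) != 0.
  rewrite mulf_neq0 // subr_eq0; apply: contraNneq y2 => yz.
  by rewrite mulNr -yz mulNr divfK // subrr.
have E : - ((y + - x / a * b) * (z + - x / a * e)) * (a * (y / b - z / e)) ^+ 2 =
    (x + - y / b * a) * (z + - y / b * e) * ((x + - z / e * a) * (y + - z / e * b)).
  by field; rewrite a0 b0 e0.
have nyz : - ((y + - x / a * b) * (z + - x / a * e)) != 0.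
  by rewrite oppr_eq0 mulf_neq0.
have := is_sqM S1 S2; rewrite -E is_sqMb ?(expf_neq0 2 nz) // is_sqX2.
by move=> /eqP ->.
Qed.

Lemma root_lin (y b l : F) : b != 0 -> y + l * b = 0 -> l = - y / b.
Proof. by move=> b0 /eqP; rewrite addrC addr_eq0 => /eqP <-; rewrite mulfK. Qed.

(* A line not crossing all three coordinate planes transversally is treated according to
   the coordinates that are constant along it. *)
Lemma in_S_line_free x y z a b e : [|| a != 0, b != 0 | e != 0] ->
  exists l : F, ~~ in_S (x + l * a) (y + l * b) (z + l * e).
Proof.
move=> nz; apply/existsP; rewrite -negb_forall; apply/negP => /forallP H.
have [a0|a0] := eqVneq a 0; last first.
  have [b0|b0] := eqVneq b 0; last first.
    have [e0|e0] := eqVneq e 0; last first.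
      by have [l] := in_S_line_free_transversal x y z a0 b0 e0; rewrite H.
    have {}H l : in_S (x + l * a) (y + l * b) z by move: (H l); rewrite e0 mulr0 addr0.
    have := H (- x / a); have := H (- y / b); rewrite !mulfVK // !subrr.
    move=> /in_S_y0[x1 z0 x1z E1 sw] /in_S_x0[y0 _ N0].
    have [ab|ab] := eqVneq a b.
      have E : - ((y + - x / a * b) * z) = (x + - y / b * a) * z.
        by rewrite ab; field; rewrite b0.
      by case/negP: N0; rewrite E is_sqMb // E1.
    (* Here the line meets x = y + z in an added point with k(1 - a) = z, so z is a nonsquare
       outside [K]. But then (x1,0,z) can only come from a swap, which needs z in [K]. *)
    pose l := (y + z - x) / (a - b).
    have El : x + l * a = y + l * b + z by rewrite /l; field; rewrite subr_eq0.
    have yl0 : y + l * b != 0.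
      apply: contraNneq x1z => yl; rewrite (_ : - y / b = l) ?El ?yl ?add0r //.
      by rewrite (root_lin b0 yl).
    have := H l; rewrite El => /(in_S_plane yl0 z0) /swap_pairP[Kk Na _ S1 [_]].
    set k := _ + z in Kk Na S1 *.
    have k0 := nsq_neq0 (nsqK Kk).
    have Ez : k * (1 - (y + l * b) / k) = z by rewrite mulrBr mulr1 mulrCA divff // mulr1 /k; ring.
    rewrite Ez => zK; case/negP: zK.
    have Nz : ~~ is_sq z by rewrite -Ez nsqMsq ?nsqK //; apply: contraNneq z0 => h; rewrite -Ez h mulr0.
    by have := sw; rewrite E1 => /(_ Nz) /swap_pairP[].
  have {}H l : in_S (x + l * a) y (z + l * e) by move: (H l); rewrite b0 mulr0 addr0.
  have := H (- x / a); rewrite mulfVK // subrr => /in_S_x0[y0 z0 N0].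
  have [e0|e0] := eqVneq e 0.
    move: z0 N0 H; rewrite e0 mulr0 addr0 => z0 N0 H.
    have {}H t : in_S t y z.
      by have := H ((t - x) / a); rewrite divfK // mulr0 addr0 addrC subrK.
    (* On the line {(t,y,z)} the point t = y + z reveals a swap, whose removed point is on the same
       line. *)
    have sw := in_S_plane y0 z0 (H _).
    have [Kk _ _ _ _] := swap_pairP sw; have k0 := nsq_neq0 (nsqK Kk).
    have := notin_S_swap sw; rewrite mulrBr mulr1 mulrCA divff // mulr1.
    by rewrite (_ : y + z - y = z) ?H //; ring.
  have := H (- z / e); rewrite mulfVK // subrr => /in_S_z0[x2 _ Nx2 Ny x2y].
  have [ae|ae] := eqVneq a e.
    have E : - (y * (z + - x / a * e)) = (x + - z / e * a) * y.
      by rewrite ae; field; rewrite e0.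
    by case/negP: N0; rewrite E nsqM.
  (* At the crossing with x = y + z, both y and k are nonsquares, so y/k is a square, which no swap
     allows. *)
  pose l := (y + z - x) / (a - e).
  have El : x + l * a = y + (z + l * e) by rewrite /l; field; rewrite subr_eq0.
  have zl0 : z + l * e != 0.
    apply: contraNneq x2y => zl; rewrite (_ : - z / e = l) ?El ?zl ?addr0 //.
    by rewrite (root_lin e0 zl).
  have := H l; rewrite El => /(in_S_plane y0 zl0) /swap_pairP[Kk Na _ _ _].
  by case/negP: Na; apply: nsqM; rewrite // is_sqV nsqK.
have {}H l : in_S x (y + l * b) (z + l * e) by move: (H l); rewrite a0 mulr0 addr0.
have [b0|b0] := eqVneq b 0.
  have {nz} e0 : e != 0 by move: nz; rewrite a0 b0 eqxx.
  have {}H t : in_S x y t.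
    by have := H ((t - z) / e); rewrite divfK // b0 mulr0 addr0 addrC subrK.
  have [x0 y0 Nx Ny xy] := in_S_z0 (H 0).
  have zn : x - y != 0 by rewrite subr_eq0.
  have := H (x - y); rewrite -{1}(subrKC y x) => /(in_S_plane y0 zn).
  rewrite subrKC => /swap_pairP[_ /negP[]].
  by rewrite nsqM ?is_sqV.
have [e0|e0] := eqVneq e 0.
  have {}H t : in_S x t z.
    by have := H ((t - y) / b); rewrite divfK // e0 mulr0 addr0 addrC subrK.
  have [x0 z0 xz E1 sw] := in_S_y0 (H 0).
  have yn : x - z != 0 by rewrite subr_eq0.
  have := H (x - z); rewrite -{1}(subrK z x) => /(in_S_plane yn z0).
  rewrite subrK => /swap_pairP[Kx _ _ _ _].
  by have [_ _ _ _ [/negP]] := swap_pairP (sw (nsqK Kx)).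
have := H (- y / b); have := H (- z / e); rewrite !mulfVK // !subrr.
move=> /in_S_z0[x0 y2 Nx Ny2 xy2] /in_S_y0[_ z1 xz1 _ /(_ Nx) sw].
have [Kz1 _ _ _ [xK _]] := swap_pairP sw.
(* As x is a nonsquare, (x,0,z1) comes from a swap with x outside [K]. If b + e = 0, then y + z = k
   along the line, which contains the removed point (x,kx,k(1-x)); otherwise the line crosses x = y
   + z, forcing x into [K]. *)
have [be|be] := eqVneq (b + e) 0.
  set k := z + _ in sw z1 Kz1.
  pose l := (k * x - y) / b.
  have E1 : y + l * b = k * x by rewrite /l divfK // addrC subrK.
  have E2 : z + l * e = k * (1 - x).
    have -> : e = - b by apply/eqP; rewrite -addr_eq0 addrC be.
    rewrite mulrN (_ : l * b = k * x - y) ?divfK // /k.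
    have -> : e = - b by apply/eqP; rewrite -addr_eq0 addrC be.
    by field; rewrite b0.
  by have := notin_S_swap sw; rewrite -E1 -E2 H.
pose l := (x - y - z) / (b + e).
have El : x = (y + l * b) + (z + l * e) by rewrite /l; field; rewrite be.
have yl0 : y + l * b != 0.
  by apply: contraNneq xz1 => yl; rewrite {1}El yl add0r (root_lin b0 yl).
have zl0 : z + l * e != 0.
  by apply: contraNneq xy2 => zl; rewrite {1}El zl addr0 (root_lin e0 zl).
have := H l; rewrite {1}El => /(in_S_plane yl0 zl0); rewrite -El => /swap_pairP[Kx _ _ _ _].
by rewrite Kx in xK.
Qed.

(** * Counting the points *)

Definition off_diag (A : {set F}) := [set u : F * F | [&& u.1 \in A, u.2 \in A & u.1 != u.2]].

Lemma card_off_diag (A : {set F}) : (#|A| * #|A| <= #|off_diag A| + #|A|)%N.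
Proof.
rewrite -cardsX -(cardsID (off_diag A) (setX A A)) leq_add ?subset_leq_card ?subsetIr //.
apply: leq_trans (leq_imset_card (fun a => (a, a)) A); apply: subset_leq_card.
apply/subsetP => -[a b]; rewrite !inE /= => /andP[+ /andP[aA bA]].
by rewrite aA bA negbK /= => /eqP <-; apply: imset_f.
Qed.

Definition swap_pairs := [set u : F * F | swap_pair u.1 u.2].

(** An excluded pair is determined by an element of K x K: (a,k) itself, or (k, k(1-a)), from which
    [D] recovers a. *)
Lemma card_swap_pairs : (#|K| * #|nsq_1Bsq| <= #|swap_pairs| + (#|K| ^ 2).*2)%N.
Proof.
pose D := [set (1 - u.2 / u.1, u.1) | u in setX K K].
rewrite mulnC -cardsX -(cardsID swap_pairs) leq_add ?subset_leq_card ?subsetIr //.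
have -> : ((#|K| ^ 2).*2 = #|setX K K| + #|setX K K|)%N by rewrite cardsX mulnn addnn.
apply: leq_trans (_ : #|setX K K :|: D| <= _)%N; last first.
  rewrite cardsU; apply: leq_trans (leq_subr _ _) _.
  by rewrite leq_add2l leq_imset_card.
apply: subset_leq_card; apply/subsetP => -[a k]; rewrite !inE /swap_pair /= !inE.
case/andP => + /andP[aR kK]; rewrite aR kK /= negb_and !negbK andbT.
case/orP => [->//|kaK]; apply/orP; right; apply/imsetP; exists (k, k * (1 - a)).
  by rewrite !inE kK.
by rewrite /= mulrC mulKf ?nsq_neq0 ?nsqK // opprB addrC subrK.
Qed.

Definition S_set := [set t : F * F * F | in_S t.1.1 t.1.2 t.2].

Definition generic_points := [set t : F * F * F |
  [&& t.1.1 != 0, t.1.2 != 0, t.2 != 0 & t.1.1 != t.1.2 + t.2]].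

(** Of the (2n)^3 points with nonzero coordinates, those on x = y + z are indexed by [Q], of size at
    most (2n)^2 - 2n. *)
Lemma card_generic_points : (8 * n ^ 3 + n.*2 <= #|generic_points| + 4 * n ^ 2)%N.
Proof.
set T := generic_points.
pose Q := [set u : F * F | [&& u.1 != 0, u.2 != 0 & u.1 + u.2 != 0]].
have cQ : (#|Q| + n.*2 <= 4 * n ^ 2)%N.
  pose D := [set (y, - y) | y in units].
  have cD : #|D| = n.*2 by rewrite card_imset ?card_units // => y1 y2 [].
  have : #|Q :|: D| = (#|Q| + #|D|)%N.
    rewrite cardsU (_ : Q :&: D = set0) ?cards0 ?subn0 //.
    apply/setP => -[y z]; rewrite !inE; apply/negP => /andP[/and3P[_ _ /= yz]].
    by case/imsetP => w _ [E1 E2]; rewrite E1 E2 subrr eqxx in yz.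
  rewrite cD => <-; rewrite (_ : 4 * n ^ 2 = #|setX units units|)%N; last first.
    by rewrite cardsX card_units; lia.
  apply: subset_leq_card; apply/subsetP => u; rewrite !inE => /orP[/and3P[-> ->] //|].
  by case/imsetP => y; rewrite inE => y0 -> /=; rewrite oppr_eq0 y0.
have : (#|setX (setX units units) units| <= #|T| + #|Q|)%N.
  rewrite -(cardsID T) leq_add ?subset_leq_card ?subsetIr //.
  apply: leq_trans (leq_imset_card (fun u => (u.1 + u.2, u.1, u.2)) Q).
  apply: subset_leq_card; apply/subsetP => -[[x y] z]; rewrite !inE /=.
  move=> /andP[+ /andP[/andP[x0 y0] z0]]; rewrite x0 y0 z0 negbK /= => /eqP E.
  by apply/imsetP; exists (y, z); rewrite ?inE /= -?E ?y0 ?z0.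
rewrite !cardsX card_units; lia.
Qed.

(** With s swap pairs, the successive pieces have at least 2n^2, n(n-1) + s, n(n-1), s and 8n^3 -
    4n^2 + 2n - s points. *)
Lemma card_S : (8 * n ^ 3 + #|swap_pairs| <= #|S_set|)%N.
Proof.
pose X0 := [set t : F * F * F | t.1.1 == 0].
pose Y0 := [set t : F * F * F | t.1.2 == 0].
pose Z0 := [set t : F * F * F | t.2 == 0].
pose P0 := [set t : F * F * F | t.1.1 == t.1.2 + t.2].
pose S1 := S_set :\: X0; pose S2 := S1 :\: Y0; pose S3 := S2 :\: Z0.
have cX : (n.*2 * n <= #|S_set :&: X0|)%N.
  rewrite -card_units -card_nsqs -cardsX.
  (* Here w = - yz is the prescribed nonsquare. *)
  rewrite -(card_in_imset (f := fun u => (0 : F, u.1, - u.2 / u.1))); last first.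
    move=> [y w] [y' w']; rewrite !inE /= => /andP[y0 _] _ [<-].
    by move=> /(mulIf (invr_neq0 y0)) /oppr_inj <-.
  apply: subset_leq_card; apply/subsetP => _ /imsetP[[y w] + ->].
  rewrite !inE /in_S eqxx /= => /andP[y0 Nw].
  have w0 := nsq_neq0 Nw.
  by rewrite y0 mulf_neq0 ?oppr_eq0 ?invr_eq0 //= mulrC divfK // opprK Nw.
have cY : (n * n + #|swap_pairs| <= #|S1 :&: Y0| + n)%N.
  have cU : (n * n + #|swap_pairs| <= #|off_diag sqs :|: swap_pairs| + n)%N.
    rewrite cardsU (_ : _ :&: _ = set0); last first.
      apply/setP => u; rewrite !inE; apply/negP.
      by case/andP => /and3P[/andP[_ Sx] _ _] /swap_pairP[_ /negP].
    by have := card_off_diag sqs; rewrite card_sqs cards0; lia.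
  apply: leq_trans cU _; rewrite leq_add2r.
  rewrite -(card_imset (f := fun u => (u.1, 0 : F, u.2))); last by move=> [? ?] [? ?] [-> ->].
  apply: subset_leq_card; apply/subsetP => _ /imsetP[[x z] + ->].
  rewrite !inE /in_S eqxx andbT /= => /orP[/and3P[/andP[x0 Sx] /andP[z0 Sz] xz]|sw].
    by rewrite (negbTE x0) z0 Sx Sz xz.
  have [/nsqK/nsq_neq0 z0 /nsq_neq0 x0 _ _ _] := swap_pairP sw.
  by rewrite (negbTE x0) z0 sw orbT.
have cZ : (n * n <= #|S2 :&: Z0| + n)%N.
  have := card_off_diag nsqs; rewrite card_nsqs => /leq_trans -> //; rewrite leq_add2r.
  rewrite -(card_imset (f := fun u => (u.1, u.2, 0 : F))); last by move=> [? ?] [? ?] [-> ->].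
  apply: subset_leq_card; apply/subsetP => _ /imsetP[[x y] + ->].
  rewrite !inE /in_S eqxx andbT /= => /and3P[Nx Ny xy].
  by rewrite (negbTE (nsq_neq0 Nx)) (negbTE (nsq_neq0 Ny)) Nx Ny.
have cP : (#|swap_pairs| <= #|S3 :&: P0|)%N.
  rewrite -(card_in_imset (f := fun u => (u.2, u.2 * u.1, u.2 * (1 - u.1)))); last first.
    move=> [a k] [a' k']; rewrite !inE /= => /swap_pairP[/nsqK/nsq_neq0 k0 _ _ _ _] _ [<-].
    by move=> /(mulfI k0) <-.
  apply: subset_leq_card; apply/subsetP => _ /imsetP[[a k] + ->].
  rewrite !inE /= => sw; have [/nsqK/nsq_neq0 k0 /nsq_neq0 a0 a1 _ _] := swap_pairP sw.
  rewrite /in_S !mulf_eq0 (negbTE k0) (negbTE a0) (negbTE a1) /= -mulrDr subrKC mulr1 eqxx andbT.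
  by rewrite mulrC mulKf.
have cG : (8 * n ^ 3 + n.*2 <= #|S3 :\: P0| + #|swap_pairs| + 4 * n ^ 2)%N.
  apply: leq_trans card_generic_points _; rewrite leq_add2r.
  rewrite -(cardsID (S3 :\: P0) generic_points).
  rewrite leq_add ?subset_leq_card ?subsetIr //.
  apply: leq_trans (leq_imset_card (fun u => (u.1, u.2 * u.1, u.2 * (1 - u.1))) swap_pairs).
  apply: subset_leq_card; apply/subsetP => -[[x y] z]; rewrite !inE /=.
  move=> /andP[+ /and4P[x0 y0 z0 xyz]].
  rewrite /in_S (negbTE x0) (negbTE y0) (negbTE z0) (negbTE xyz) /= negbK => /andP[sw /eqP E].
  apply/imsetP; exists (x, y + z); rewrite ?inE //= -E mulrBr mulr1 -E.
  by congr (_, _, _); ring.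
have := cardsID X0 S_set; have := cardsID Y0 S1; have := cardsID Z0 S2; have := cardsID P0 S3.
rewrite -/S1 -/S2 -/S3; lia.
Qed.

(** Doubling clears the half in the bound (n-1)/2 for the size of [nsq_1Bsq]. *)
Lemma card_S_ge :
  (16 * n ^ 3 + #|K| * n <= #|S_set|.*2 + #|K| + 4 * #|K| ^ 2)%N.
Proof.
have := card_S; have := card_swap_pairs.
have := leq_mul (leqnn #|K|) card_nsq_1Bsq; rewrite mulnS -mul2n mulnCA; lia.
Qed.

End LineFreeSet.

(** * Choice of [K] of size about sqrt p and the final estimate *)

Lemma exists_isqrt (p : nat) : exists m : nat, (m ^ 2 <= p < m.+1 ^ 2)%N.
Proof.
elim: p => [|p [m /andP[m1 m2]]]; first by exists 0%N.
have [lt|ge] := ltnP p.+1 (m.+1 ^ 2); first by exists m; rewrite lt (leq_trans m1).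
by exists m.+1; rewrite ge; apply: leq_ltn_trans m2 _; rewrite ltn_exp2r.
Qed.

Lemma exists_subset_card (T : finType) (A : {set T}) m : (m <= #|A|)%N ->
  exists2 K : {set T}, K \subset A & #|K| = m.
Proof.
move=> mA; exists [set x in take m (enum A)].
  by apply/subsetP => x; rewrite inE => /mem_take; rewrite mem_enum.
by rewrite cardsE (card_uniqP (take_uniq _ (enum_uniq _))) size_takel // -cardE.
Qed.

Lemma r_p3_ge p n m : prime p -> p = n.*2.+1 -> (m ^ 2 <= p)%N ->
  (16 * n ^ 3 + m * n <= (r_p3 p).*2 + m + 4 * m ^ 2)%N.
Proof.
move=> p_pr pE mp; have p1 := prime_gt1 p_pr.
have F2 : (2 : 'F_p) != 0.
  rewrite -[2]/(2%:R) -(dvdn_pcharf (pchar_Fp p_pr)) pE.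
  by apply/negP => /dvdn_leq => /(_ isT); lia.
have cF : #|'F_p| = n.*2.+1 by rewrite card_Fp.
have mn : (m <= #|nsqs 'F_p|)%N by rewrite (card_nsqs F2 cF); nia.
have [K subK cK] := exists_subset_card mn.
pose S := [set v : 'rV['F_p]_3 | in_S K (v 0 0) (v 0 1) (v 0 2)].
have lfS : line_free S.
  apply/forallP => a; apply/forallP => v; apply/implyP => v0.
  rewrite negb_forall; apply/existsP.
  have nz : [|| v 0 0 != 0, v 0 1 != 0 | v 0 2 != 0].
    apply: contraNT v0; rewrite !negb_or !negbK => /and3P[/eqP v0 /eqP v1 /eqP v2].
    apply/eqP/rowP => -[[|[|[|//]]] i3]; rewrite mxE.
    - by rewrite -[RHS]v0; congr (v _ _); apply: val_inj.
    - by rewrite -[RHS]v1; congr (v _ _); apply: val_inj.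
    - by rewrite -[RHS]v2; congr (v _ _); apply: val_inj.
  have [l Hl] := in_S_line_free F2 cF subK (a 0 0) (a 0 1) (a 0 2) nz.
  by exists l; rewrite inE !mxE.
have cS : (#|S_set K| <= #|S|)%N.
  pose pt (t : 'F_p * 'F_p * 'F_p) : 'rV_3 :=
    \row_(i < 3) (if i == 0 then t.1.1 else if i == 1 then t.1.2 else t.2).
  have pt_inj : injective pt.
    move=> [[x y] z] [[x' y'] z'] /rowP E.
    by have := E 0; have := E 1; have := E 2; rewrite !mxE /= => -> -> ->.
  rewrite -(card_imset _ pt_inj); apply: subset_leq_card.
  by apply/subsetP => _ /imsetP[[[x y] z] + ->]; rewrite !inE !mxE.
have {cS lfS} Sr : (#|S_set K| <= r_p3 p)%N by apply: leq_trans cS (leq_bigmax_cond _ lfS).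
have := card_S_ge F2 cF subK; rewrite cK => /leq_trans -> //.
by rewrite !leq_add2r leq_double.
Qed.

(* p^{3/2} is written p * sqrt p; the inequality is stated in an arbitrary
   real closed field R (e.g. the reals). *)
Theorem theorem3 (R : rcfType) (p : nat) :
  prime p -> (3 <= p)%N ->
  (p%:R ^+ 3 - 3 * p%:R ^+ 2 + 8^-1 * (p%:R * Num.sqrt (p%:R : R))
     - (7 / 16) * p%:R) <= (r_p3 p)%:R.
Proof.
move=> p_pr p3; have [m /andP[m1 m2]] := exists_isqrt p.
have [n pE] : exists n, p = n.*2.+1.
  exists p./2; have := odd_double_half p.
  by case: (even_prime p_pr) => [p2|->] //; rewrite p2 in p3.
have := r_p3_ge p_pr pE m1; set r := r_p3 p.
have sq : Num.sqrt (p%:R : R) <= m%:R + 1.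
  rewrite natr1 -[leRHS]ger0_norm // -sqrtr_sqr ler_sqrt ?exprn_ge0 //.
  by rewrite -natrX ler_nat ltnW.
have mn : (m <= n)%N by nia.
rewrite -(ler_nat R) !natrD -!muln2 !natrM ?natrX => H.
have M1 : (m%:R ^+ 2 : R) <= n%:R * 2 + 1.
  by rewrite -natrX -natrM natr1 ler_nat muln2 -pE.
have MN : (m%:R : R) <= n%:R by rewrite ler_nat.
have M0 : (0 : R) <= m%:R by [].
have N1 : (1 : R) <= n%:R by rewrite ler1n; lia.
have PE : (p%:R : R) = n%:R * 2 + 1 by rewrite pE -natr1 -muln2 natrM.
move: sq; rewrite PE; set s := Num.sqrt _ => sq.
have sqN : (n%:R * 2 + 1) * s <= (n%:R * 2 + 1) * (m%:R + 1) :> R.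
  by rewrite ler_wpM2l // -PE.
have MN1 : (m%:R : R) <= m%:R * n%:R by rewrite ler_peMr.
(* Since p^3 - 3p^2 = 8n^3 - 6n - 2 and m^2 <= 2n + 1, the slack is at least mn/4 - 5m/8 + 21n/8 +
   5/16, which is positive because m <= n. *)
move: H sqN M1 MN M0 N1 MN1; move: (m%:R : R) (n%:R : R) (r%:R : R) (s : R) => M N r' s'.
move=> H sqN M1 MN M0 N1 MN1; nra.
Qed.
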